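(* Let $S$ be a pointed affine semigroup. There exists a one-to-one correspondence between $\operatorname{Der}(\mathbb{C}[S])$ and $\operatorname{Der}(\mathbb{C}[S_\infty])$.
   Context: An affine semigroup is a commutative semigroup $S$ (written additively) with identity $0$ which is finitely generated and embeddable in a lattice $M\simeq\mathbb{Z}^n$ for some integer $n\geq 0$. It is pointed if $\{0\}$ is a face of $S$, equivalently if $a+b=0$ with $a,b\in S$ implies $a=b=0$. $S_\infty=S\cup\{\infty\}$ is the semigroup whose operation extends that of $S$ by $a+\infty=\infty+a=\infty$ for all $a\in S_\infty$. For a semigroup $T$ with identity $0$, $\mathbb{C}[T]=\bigoplus_{a\in T}\mathbb{C}\cdot\chi^a$ is the semigroup algebra, where the $\chi^a$ are formal elements with $\chi^a\chi^b=\chi^{a+b}$ and $1=\chi^0$. For a $\mathbb{C}$-algebra $B$, a derivation on $B$ is an endomorphism $\partial\colon B\to B$ such that $\partial(fg)=f\partial(g)+g\partial(f)$ for all $f,g\in B$, and $\operatorname{Der}(B)$ denotes the set of derivations on $B$. The algebras are considered here without topology. *)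

(* Defs.v *)
From HB Require Import structures.
From mathcomp Require Import all_boot all_order all_algebra.
From mathcomp Require Import finmap.
From mathcomp.multinomials Require Import monalg.
From mathcomp Require Import boolp classical_sets functions reals complex.

Set Implicit Arguments.
Unset Strict Implicit.
Unset Printing Implicit Defensive.

Import GRing.Theory.

Local Open Scope ring_scope.

(* Commutative semigroups with identity, written additively, are [nmodType]s. *)

Definition finitely_generated (S : nmodType) : Prop :=
  exists (k : nat) (g : 'I_k -> S),
    forall a : S, exists c : 'I_k -> nat, a = \sum_(i < k) g i *+ c i.

Definition lattice_embeddable (S : nmodType) : Prop :=
  exists (n : nat) (f : {additive S -> 'rV[int]_n}), injective f.

Definition affine_semigroup (S : nmodType) : Prop :=
  finitely_generated S /\ lattice_embeddable S.

Definition is_face (S : nmodType) (F : set S) : Prop :=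
  [/\ F 0, (forall a b, F a -> F b -> F (a + b))
    & (forall a b, F (a + b) -> F a /\ F b)].

Definition pointed (S : nmodType) : Prop := is_face [set (0 : S)]%classic.

Lemma pointedP (S : nmodType) :
  pointed S <-> (forall a b : S, a + b = 0 -> a = 0 /\ b = 0).
Proof.
split=> [[_ _ h] a b /h //|h]; split; first by [].
  by move=> a b /= -> ->; rewrite addr0.
by move=> a b /= /h.
Qed.

(* [None] plays the role of the absorbing element. *)
Definition with_infty (S : Type) : Type := option S.

HB.instance Definition _ (S : choiceType) := Choice.on (with_infty S).

Section WithInfty.
Context (S : nmodType).

Definition add_infty (a b : with_infty S) : with_infty S :=
  match a, b with
  | Some x, Some y => Some (x + y)
  | _, _ => None
  end.

Let zero_infty : with_infty S := Some 0.

Fact add_inftyA : associative add_infty.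
Proof. by move=> [a|] [b|] [c|] //=; rewrite addrA. Qed.

Fact add_inftyC : commutative add_infty.
Proof. by move=> [a|] [b|] //=; rewrite addrC. Qed.

Fact add0_infty : left_id zero_infty add_infty.
Proof. by move=> [a|] //=; rewrite add0r. Qed.

HB.instance Definition _ :=
  GRing.isNmodule.Build (with_infty S) add_inftyA add_inftyC add0_infty.

End WithInfty.

(* The semigroup algebra.  The ring structure that [monalg] puts on
   [{malg K[T]}] is only available when [T] has no nontrivial units, so the
   convolution product is defined here for every commutative semigroup with
   identity, on top of the K-module [{malg K[T]}] of finitely supported
   functions from T to K. *)
Definition sgalg (K : comNzRingType) (T : nmodType) : Type := {malg K[T]}.

Section SemigroupAlgebra.
Context (K : comNzRingType) (T : nmodType).

HB.instance Definition _ := GRing.Lmodule.copy (sgalg K T) {malg K[T]}.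

Implicit Types f g h : sgalg K T.

Definition chi (a : T) : sgalg K T := mkmalgU a 1.

Definition sgmul f g : sgalg K T :=
  \sum_(a <- msupp f) \sum_(b <- msupp g) (mcoeff a f * mcoeff b g) *: chi (a + b).

Let sgmulw (A B : {fset T}) f g :
    (msupp f `<=` A)%fset -> (msupp g `<=` B)%fset ->
  sgmul f g =
    \sum_(a <- A) \sum_(b <- B) (mcoeff a f * mcoeff b g) *: chi (a + b).
Proof.
move=> sA sB; rewrite /sgmul (big_fset_incl _ sA) /=.
  apply: eq_bigr => a _; apply: big_fset_incl => // b _ /mcoeff_outdom ->.
  by rewrite mulr0 scale0r.
move=> a _ /mcoeff_outdom fa.
by rewrite big1 // => b _; rewrite fa mul0r scale0r.
Qed.

Fact sgmulC : commutative sgmul.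
Proof.
move=> f g; rewrite /sgmul exchange_big; apply: eq_bigr => a _.
by apply: eq_bigr => b _; rewrite mulrC addrC.
Qed.

Fact sgmulDl : left_distributive sgmul +%R.
Proof.
move=> f g h; pose A := (msupp f `|` msupp g)%fset.
rewrite (@sgmulw A (msupp h) (f + g)) ?msuppD_le //.
rewrite (@sgmulw A (msupp h) f) ?fsubsetUl //.
rewrite (@sgmulw A (msupp h) g) ?fsubsetUr // -big_split.
apply: eq_bigr => a _; rewrite -big_split; apply: eq_bigr => b _.
by rewrite mcoeffD mulrDl scalerDl.
Qed.

Let sgmulDr : right_distributive sgmul +%R.
Proof. by move=> f g h; rewrite !(sgmulC f) sgmulDl. Qed.

Fact sgmulZl (c : K) f g : c *: sgmul f g = sgmul (c *: f) g.
Proof.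
rewrite (@sgmulw (msupp f) (msupp g) (c *: f)) ?msuppZ_le //.
rewrite /sgmul scaler_sumr; apply: eq_bigr => a _.
rewrite scaler_sumr; apply: eq_bigr => b _.
by rewrite mcoeffZ scalerA mulrA.
Qed.

Let sgmulZr (c : K) f g : c *: sgmul f g = sgmul f (c *: g).
Proof. by rewrite sgmulC sgmulZl sgmulC. Qed.

Let sgmul0 g : sgmul 0 g = 0.
Proof. by rewrite /sgmul msupp0 big_seq_fset0. Qed.

Let sgmulr0 g : sgmul g 0 = 0.
Proof. by rewrite sgmulC sgmul0. Qed.

Lemma sgalgE f : f = \sum_(a <- msupp f) mcoeff a f *: chi a.
Proof.
rewrite {1}(monalgE f); apply: eq_bigr => a _.
by apply/malgP => b; rewrite mcoeffZ !mcoeffU mulr_natr.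
Qed.

Let chi_mul a b : sgmul (chi a) (chi b) = chi (a + b).
Proof.
rewrite (@sgmulw [fset a]%fset [fset b]%fset); try exact: msuppU_le.
by rewrite !big_seq_fset1 !mcoeffUU mulr1 scale1r.
Qed.

Lemma sgalg_ind (P : sgalg K T -> Prop) :
    P 0 -> (forall c a f, P f -> P (c *: chi a + f)) -> forall f, P f.
Proof.
move=> P0 PD f; rewrite (sgalgE f); elim: (enum_fset _) => [|a r IH].
  by rewrite big_nil.
by rewrite big_cons; exact: PD.
Qed.

Let chi_mulA a b h : sgmul (chi a) (sgmul (chi b) h) = sgmul (chi (a + b)) h.
Proof.
elim/sgalg_ind: h => [|e x h IHh]; first by rewrite !sgmulr0.
rewrite (sgmulDr (chi b)) (sgmulDr (chi a)) (sgmulDr (chi (a + b))) IHh.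
by rewrite -!sgmulZr !chi_mul addrA.
Qed.

Let chi_mulA2 a g h : sgmul (chi a) (sgmul g h) = sgmul (sgmul (chi a) g) h.
Proof.
elim/sgalg_ind: g => [|d b g IHg]; first by rewrite sgmul0 sgmulr0 sgmul0.
rewrite (sgmulDl _ g h) 2!(sgmulDr (chi a)) (sgmulDl _ (sgmul (chi a) g)) IHg.
by rewrite -sgmulZl -2!sgmulZr -sgmulZl chi_mul chi_mulA.
Qed.

Fact sgmulA : associative sgmul.
Proof.
move=> f g h; elim/sgalg_ind: f => [|c a f IHf]; first by rewrite 3!sgmul0.
rewrite (sgmulDl _ f (sgmul g h)) (sgmulDl _ f g) (sgmulDl _ (sgmul f g)) IHf.
by rewrite -3!sgmulZl chi_mulA2.
Qed.

Fact sgmul1 : left_id (chi 0) sgmul.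
Proof.
elim/sgalg_ind => [|c a f IH]; first exact: sgmulr0.
by rewrite sgmulDr IH -sgmulZr chi_mul add0r.
Qed.

Fact chi0_neq0 : chi 0 != 0.
Proof. by rewrite monalgU_eq0 oner_eq0. Qed.

HB.instance Definition _ := GRing.Zmodule_isComNzRing.Build (sgalg K T)
  sgmulA sgmulC sgmul1 sgmulDl chi0_neq0.

HB.instance Definition _ :=
  GRing.Lmodule_isLalgebra.Build K (sgalg K T) sgmulZl.

HB.instance Definition _ :=
  GRing.Lalgebra_isComAlgebra.Build K (sgalg K T).

Lemma chi0 : chi 0 = 1.
Proof. by []. Qed.

Lemma chiD a b : chi (a + b) = chi a * chi b.
Proof. by rewrite -chi_mul. Qed.

End SemigroupAlgebra.

Definition Der (K : comNzRingType) (B : comAlgType K) : set (B -> B) :=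
  [set d | linear d /\ forall f g : B, d (f * g) = f * d g + g * d f]%classic.

Arguments Der K B : clear implicits.

(* Main.v *)
(* With e the basis element of infinity, e is idempotent and C[S_oo] e = C e, so
   C[S_oo] = C e x (1 - e) C[S_oo], and the second factor is isomorphic to C[S]
   by killing e.  A derivation vanishes on idempotents, hence respects the
   product, and it is zero on the factor C e. *)
Require Import Defs.
From HB Require Import structures.
From mathcomp Require Import all_boot all_order all_algebra.
From mathcomp Require Import finmap.
From mathcomp.multinomials Require Import monalg.
From mathcomp Require Import boolp classical_sets functions reals complex.

Set Implicit Arguments.
Unset Strict Implicit.
Unset Printing Implicit Defensive.

Import GRing.Theory.

Local Open Scope ring_scope.

(** Leibniz on [e * e] gives [D e = 2 e D e]; multiplying by [e] gives [e D e = 2 e D e], so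
    [e D e = 0] and then [D e = 0]. No division by 2 occurs. *)
Lemma Der_idem (K : comNzRingType) (B : comAlgType K) (D : B -> B) (e : B) :
  Der K B D -> e * e = e -> D e = 0.
Proof.
move=> [_ DM] ee; have De : D e = e * D e + e * D e by rewrite -DM ee.
have eDe : e * D e = 0.
  have := congr1 ( *%R e) De; rewrite mulrDr mulrA ee => eDe.
  by apply: (addrI (e * D e)); rewrite addr0 -eDe.
by rewrite De eDe addr0.
Qed.

Section SplitExtension.
Context (K : comNzRingType) (A B : comAlgType K).
Context (iota : {lrmorphism A -> B}) (pi : {lrmorphism B -> A}) (e : B).
Hypothesis iotaK : cancel iota pi.
Hypothesis ee : e * e = e.
Hypothesis pie : pi e = 0.
Hypothesis ker_pi : forall f, pi f = 0 -> exists c : K, f = c *: e.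

(** Without the factor [1 - e] the Leibniz rule could fail: [iota (pi f)] agrees with [f] only up to
    a multiple of [e], which [1 - e] kills. *)
Definition Der_extend (d : A -> A) (f : B) : B := (1 - e) * iota (d (pi f)).

Let mul_e f : exists c : K, e * f = c *: e.
Proof. by apply: ker_pi; rewrite rmorphM /= pie mul0r. Qed.

Let iota_pi f : exists c : K, iota (pi f) = f + c *: e.
Proof.
have [|c fc] := ker_pi (f := iota (pi f) - f); first by rewrite raddfB /= iotaK subrr.
by exists c; rewrite -fc addrC subrK.
Qed.

Let mul_idemC_iota_pi f : (1 - e) * iota (pi f) = (1 - e) * f.
Proof.
have [c ->] := iota_pi f.
by rewrite mulrDr -scalerAr [_ * e]mulrBl mul1r ee subrr scaler0 addr0.
Qed.

Lemma Der_extend_bij : set_bij (Der K A) (Der K B) Der_extend.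
Proof.
split.
- move=> d [dl dM]; split=> [c f g|f g]; rewrite /Der_extend.
    by rewrite linearP dl linearP mulrDr scalerAr.
  (* Next to [1 - e], each coefficient [iota (pi f)] may be replaced by [f]. *)
  rewrite rmorphM dM rmorphD !rmorphM mulrDr !mulrA !mul_idemC_iota_pi.
  by rewrite ![(1 - e) * _]mulrC -!mulrA.
(* Since [pi (1 - e) = 1], evaluating at [iota a] and applying [pi] recovers [d a]. *)
- move=> d d' _ _ dd'; apply/funext => a.
  have /(congr1 pi) := congr1 (@^~ (iota a)) dd'.
  by rewrite /Der_extend !rmorphM /= !iotaK rmorphB rmorph1 /= pie subr0 !mul1r.
- move=> D DD; have De := Der_idem DD ee; have [Dl DM] := DD.
  have DcE c f : D (f + c *: e) = D f.
    by rewrite addrC Dl De scaler0 add0r.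
  (* As [D e = 0], Leibniz gives [e * D f = D (e * f)], and [e * f] is a multiple of [e]. The value
     [D 0 = 0] comes from the idempotent [0]. *)
  have eD f : e * D f = 0.
    have [c ef] := mul_e f.
    have := DM e f; rewrite De mulr0 addr0 ef => <-.
    by rewrite -[c *: e]add0r DcE (Der_idem DD (mulr0 0)).
  (* The preimage of [D] restricts it along [iota] and projects back; extending it returns
     [(1 - e) * D f], which is [D f] because [e * D f = 0]. *)
  exists (pi \o D \o iota) => /=.
    split=> [c f g|f g] /=; first by rewrite linearP Dl linearP.
    by rewrite rmorphM /= DM rmorphD !rmorphM /= !iotaK.
  apply/funext => f; rewrite /Der_extend /= mul_idemC_iota_pi.
  have [c ->] := iota_pi f.
  by rewrite DcE mulrBl mul1r eD subr0.
Qed.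

End SplitExtension.

Section Lift.
Context (K : comNzRingType) (T : nmodType) (B : comAlgType K) (phi : T -> B).

Definition sgalg_lift (f : sgalg K T) : B :=
  \sum_(a <- msupp f) mcoeff a f *: phi a.

Lemma sgalg_liftw (X : {fset T}) (f : sgalg K T) :
  (msupp f `<=` X)%fset -> sgalg_lift f = \sum_(a <- X) mcoeff a f *: phi a.
Proof.
move=> sX; apply: big_fset_incl => // a _ /mcoeff_outdom ->.
by rewrite scale0r.
Qed.

Lemma sgalg_lift_linear : linear sgalg_lift.
Proof.
move=> c f g; pose X := (msupp f `|` msupp g)%fset.
rewrite (@sgalg_liftw X f) ?fsubsetUl // (@sgalg_liftw X g) ?fsubsetUr //.
rewrite (@sgalg_liftw X); last first.
  by apply: fsubset_trans (msuppD_le _ _) _; rewrite fsetSU ?msuppZ_le.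
rewrite scaler_sumr -big_split; apply: eq_bigr => a _ /=.
by rewrite mcoeffD mcoeffZ scalerDl scalerA.
Qed.

HB.instance Definition _ :=
  GRing.isLinear.Build K (sgalg K T) B _ sgalg_lift sgalg_lift_linear.

Lemma sgalg_lift_chi a : sgalg_lift (chi K a) = phi a.
Proof.
rewrite (@sgalg_liftw [fset a]%fset) ?msuppU_le //.
by rewrite big_seq_fset1 mcoeffUU scale1r.
Qed.

(** Both sides of multiplicativity are bilinear, so induction on each factor reduces it to basis
    elements. *)
Lemma sgalg_lift_monoid_morphism :
  phi 0 = 1 -> {morph phi : a b / a + b >-> a * b} ->
  monoid_morphism sgalg_lift.
Proof.
move=> phi0 phiD; split=> [|f g]; first by rewrite -chi0 sgalg_lift_chi.
elim/sgalg_ind: f g => [|c a f IHf] g; first by rewrite mul0r linear0 mul0r.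
rewrite mulrDl -scalerAl !linearP /= mulrDl IHf -scalerAl; congr (_ *: _ + _).
elim/sgalg_ind: g => [|d b g IHg]; first by rewrite mulr0 linear0 mulr0.
rewrite mulrDr -scalerAr !linearP /= mulrDr IHg -scalerAr -chiD.
by rewrite !sgalg_lift_chi phiD.
Qed.

End Lift.

Section Infinity.
Context (K : comNzRingType) (S : nmodType).

Let incl_phi (a : S) : sgalg K (with_infty S) := chi K (Some a : with_infty S).
Let proj_phi (a : with_infty S) : sgalg K S :=
  if a is Some b then chi K b else 0.

Definition sgalg_incl := sgalg_lift incl_phi.
Definition sgalg_proj := sgalg_lift proj_phi.

Fact sgalg_incl_monoid_morphism : monoid_morphism sgalg_incl.
Proof. by apply: sgalg_lift_monoid_morphism => // a b; rewrite -chiD. Qed.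

(** Sending infinity to [0] is multiplicative because both are absorbing. *)
Fact sgalg_proj_monoid_morphism : monoid_morphism sgalg_proj.
Proof.
apply: sgalg_lift_monoid_morphism => // -[a|] [b|] /=;
  by rewrite ?mulr0 ?mul0r // -chiD.
Qed.

HB.instance Definition _ := GRing.Linear.on sgalg_incl.
HB.instance Definition _ := GRing.isMonoidMorphism.Build _ _ sgalg_incl
  sgalg_incl_monoid_morphism.
HB.instance Definition _ := GRing.Linear.on sgalg_proj.
HB.instance Definition _ := GRing.isMonoidMorphism.Build _ _ sgalg_proj
  sgalg_proj_monoid_morphism.

Lemma sgalg_projE (a : with_infty S) :
  sgalg_proj (chi K a) = if a is Some b then chi K b else 0.
Proof. exact: sgalg_lift_chi. Qed.

Lemma sgalg_inclE (a : S) : sgalg_incl (chi K a) = chi K (Some a : with_infty S).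
Proof. exact: sgalg_lift_chi. Qed.

Lemma sgalg_inclK : cancel sgalg_incl sgalg_proj.
Proof.
elim/sgalg_ind => [|c a f IHf]; first by rewrite !linear0.
by rewrite !linearP /= IHf sgalg_inclE sgalg_projE.
Qed.

(** This identifies the kernel of [sgalg_proj] as the line spanned by the basis element of
    infinity. *)
Lemma sgalg_incl_projP f :
  exists c : K, f = sgalg_incl (sgalg_proj f) + c *: chi K (None : with_infty S).
Proof.
elim/sgalg_ind: f => [|d a f [c IHf]].
  by exists 0; rewrite !linear0 scale0r addr0.
rewrite !linearP /= sgalg_projE; case: a => [a|].
  by exists c; rewrite sgalg_inclE -addrA -IHf.
(* A term at infinity is killed by the projection, so its coefficient [d] joins [c]. *)
by exists (d + c); rewrite linear0 scaler0 add0r {1}IHf scalerDl addrCA.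
Qed.

End Infinity.

Theorem theorem3p7 (R : realType) (S : nmodType)
    (affS : affine_semigroup S) (ptS : pointed S) :
  exists Phi : (sgalg R[i] S -> sgalg R[i] S) ->
               (sgalg R[i] (with_infty S) -> sgalg R[i] (with_infty S)),
    set_bij (Der R[i] (sgalg R[i] S)) (Der R[i] (sgalg R[i] (with_infty S)))
      Phi.
Proof.
exists (Der_extend (@sgalg_incl R[i] S) (@sgalg_proj R[i] S) (chi R[i] (None : with_infty S))).
apply: Der_extend_bij.
- exact: sgalg_inclK.
(* Idempotence of [e] is infinity + infinity = infinity. *)
- by rewrite -chiD.
- exact: sgalg_projE.
- move=> f f0; have [c fE] := sgalg_incl_projP f.
  by exists c; rewrite fE f0 linear0 add0r.
Qed.
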